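(* A graph $G$ is resistance nonnegative if and only if $P(G)^{\circ}\cap 2M(G)$ is non-empty, where $P(G)^\circ$ is the relative interior of the spanning tree polytope of $G$ and $2M(G)$ is the twice-dilated matching polytope of $G$.
   Context: All graphs $G=(V,E)$ are finite, simple (no multi-edges), loopless and connected. A spanning tree of $G$ is a maximal acyclic subset of edges $T\subseteq E$. A matching is a (possibly empty) subset of edges $M\subseteq E$ which covers every vertex at most once. For $A\subseteq E$ let $e_A=\sum_{i\in A}e_i\in\mathbb{R}^E$, with $(e_i)_{i\in E}$ the standard basis. The spanning tree polytope is $P(G)=\operatorname{conv}(e_T\mid T\text{ is a spanning tree})\subset\mathbb{R}^E$; $P(G)^\circ$ is its relative interior in its affine hull (for a tree $G$ this is a single point). The matching polytope is $M(G)=\operatorname{conv}(e_M\mid M\text{ is a matching})\subset\mathbb{R}^E$, and $2M(G)=\{2x\mid x\in M(G)\}$. For edge weights $c=(c_e)_{e\in E}$ with $0<c_e<\infty$, the relative resistance of $e\in E$ is $r_e(c)=\frac{\sum_{T\ni e}\prod_{t\in T}c_t}{\sum_{T}\prod_{t\in T}c_t}$, with sums over spanning trees $T$, and the resistance curvature of $v\in V$ is $p_v(c)=1-\frac12\sum_{uv\in E}r_{uv}(c)$ (sum over edges incident to $v$). $G$ is resistance nonnegative (RN) if there exist weights $c$ with $p_v(c)\ge 0$ for all $v\in V$. *)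

(* Defs.v *)
From mathcomp Require Import all_boot all_order all_algebra.
From mathcomp Require Import all_classical all_reals.
From mathcomp Require Import topology normedtype convex.

Set Implicit Arguments.
Unset Strict Implicit.
Unset Printing Implicit Defensive.

Import Order.TTheory GRing.Theory Num.Theory.
Import numFieldNormedType.Exports.

Local Open Scope classical_set_scope.
Local Open Scope ring_scope.

Section Hulls.
Context {R : realType}.

Definition convex_hull (M : lmodType R) (A : set M) : set M :=
  smallest (@convex_set R M) A.

Definition affine_set (M : lmodType R) (A : set M) : Prop :=
  forall (x y : M) (t : R), A x -> A y -> A (t *: x + (1 - t) *: y).

Definition affine_hull (M : lmodType R) (A : set M) : set M :=
  smallest (@affine_set M) A.

(* Interior in the subspace topology that the affine hull inherits from R^I.
   For a finite index type I, [{ptws I -> R}] carries the usual topology of R^I.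
   [subspace B] makes the points outside B isolated, but the interior of A only
   contains points of A, and these lie in its affine hull. *)
Definition relative_interior (I : finType) (A : set (I -> R^o)) :
    set (I -> R^o) :=
  interior (A : set (subspace (affine_hull A : set {ptws I -> R}))).

End Hulls.

(* A graph is given by its finite vertex type V and its adjacency relation; the
   statement assumes the latter symmetric, irreflexive and connected. *)
Section Graph.
Context {V : finType} (adj : rel V).

Definition is_edge (A : {set V}) : bool :=
  [exists u, exists v, adj u v && (A == [set u; v]%SET)].

Definition edge : finType := {A : {set V} | is_edge A}.

Definition joined_in (A : {set edge}) : rel V :=
  fun u v => [exists e in A, val e == [set u; v]%SET].

(* Cycles have at least three vertices; for a smaller closed walk u, v, u the
   predicate [ucycle] would hold as soon as uv lies in A. *)
Definition acyclic (A : {set edge}) : Prop :=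
  ~ exists2 c : seq V, (2 < size c)%N & ucycle (joined_in A) c.

Definition spanning_tree (T : {set edge}) : bool :=
  maxset (fun A => `[< acyclic A >]) T.

Definition matching (M : {set edge}) : bool :=
  [forall v, #|[set e in M | v \in val e]%SET| <= 1]%N.

Variable R : realType.

(* The codomain is R^o so that R^E gets its vector space structure over R. *)
Definition indicator_vec (A : {set edge}) : edge -> R^o :=
  fun e => (e \in A)%:R.

Definition spanning_tree_polytope : set (edge -> R^o) :=
  convex_hull [set indicator_vec T | T in [set T | spanning_tree T]].

Definition matching_polytope : set (edge -> R^o) :=
  convex_hull [set indicator_vec M | M in [set M | matching M]].

Definition dilate (a : R) (A : set (edge -> R^o)) : set (edge -> R^o) :=
  [set a *: x | x in A].

Definition relative_resistance (c : edge -> R) (e : edge) : R :=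
  (\sum_(T : {set edge} | spanning_tree T && (e \in T)) \prod_(t in T) c t) /
  (\sum_(T : {set edge} | spanning_tree T) \prod_(t in T) c t).

Definition resistance_curvature (c : edge -> R) (v : V) : R :=
  1 - 2^-1 * \sum_(e : edge | v \in val e) relative_resistance c e.

Definition resistance_nonnegative : Prop :=
  exists c : edge -> R,
    (forall e, 0 < c e) /\ (forall v, 0 <= resistance_curvature c v).

End Graph.

Arguments spanning_tree_polytope {V} adj R.
Arguments matching_polytope {V} adj R.

(* Main.v *)
Require Import Defs.
From mathcomp Require Import all_boot all_order all_algebra.
From mathcomp Require Import fingroup perm.
From mathcomp Require Import zify ring lra.

(** Write [x = r(c)] for the vector of relative resistances.  It is the mean of
    the indicator vectors of the spanning trees [T] under the probability
    proportional to [\prod_(t in T) c t].  A point of a polytope is relatively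
    interior iff it is a convex combination of the generators with positive
    coefficients, so [x] lies in [P(G)°].  Conversely, among all probabilities on
    trees with mean a given [x] in [P(G)°], the one of maximal entropy is
    positive, and its logarithm is orthogonal to every vector that preserves the
    mean; hence it has the product form above, and [x = r(c)] for some [c].
    So [G] is RN iff some [x] in [P(G)°] has [x(delta(v)) <= 2] for all [v].
    For such [x] the bound [x(E[K]) <= |K| - 1] (a forest has at most [|K| - 1]
    edges inside [K]) turns these degree bounds into Edmonds' inequalities for
    [x / 2], and Edmonds' matching polytope theorem gives [x / 2] in [M(G)].

    Edmonds' theorem is proved after Lovász: by Gallai's lemma, the matchings
    maximising a nonzero weight all satisfy one of Edmonds' inequalities with
    equality; induction on the number of non-maximal matchings then bounds the
    weight of every feasible vector by that of a maximal matching. *)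

Set Implicit Arguments.
Unset Strict Implicit.
Unset Printing Implicit Defensive.
Import Order.TTheory GRing.Theory Num.Theory.

(** * Maximal weight matchings *)

(** For [f] and [g] the partner maps of two matchings, [S] is the vertex set of the alternating path
    starting at [t]. It is the orbit of [t] under the product [s] of the two involutions: each of
    them reverses this orbit, and a point [s^k t] fixed by [f] gives [t] the odd period
    [2 k + 1]. *)
Lemma dihedral_orbit (T : finType) (f g : T -> T) (t : T) :
    involutive f -> involutive g -> g t = t ->
  exists S : {set T}, [/\ t \in S, forall x, x \in S -> f x \in S,
    forall x, x \in S -> g x \in S &
    {in S &, forall u v, f u = u -> f v = v -> u = v}].
Proof.
move=> fK gK gt; pose s := (perm (inv_inj fK) * perm (inv_inj gK))%g.
have sE x : s x = g (f x) by rewrite permM !permE.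
have gs x : g (s x) = s^-1%g (g x).
  by apply: (@perm_inj _ s); rewrite permKV !sE gK fK.
have gX k : g ((s ^+ k)%g t) = (s ^- k)%g t.
  elim: k => [|k IH]; first by rewrite expg0 invg1 !perm1 gt.
  by rewrite expgSr permM gs IH -permM -invMg -expgS -expgSr.
have fX k : f ((s ^+ k)%g t) = (s ^- k.+1)%g t.
  by rewrite -gX expgSr permM sE gK.
have inV k : (s ^- k)%g t \in porbit s t.
  rewrite porbit_sym; apply/porbitP; exists k.
  by rewrite -permM mulVg perm1.
exists (porbit s t); split.
- exact: porbit_id.
- by move=> x /porbitP[k ->]; rewrite fX inV.
- by move=> x /porbitP[k ->]; rewrite gX inV.
have odd_fix k : f ((s ^+ k)%g t) = (s ^+ k)%g t -> (s ^+ k.*2.+1)%g t = t.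
  rewrite fX => h; rewrite -addnn -addnS expgD permM -h -permM mulVg.
  by rewrite perm1.
have mul_fix k n : (s ^+ k)%g t = t -> (s ^+ (k * n))%g t = t.
  move=> h; rewrite expgM; elim: n => [|n IH]; first by rewrite expg0 perm1.
  by rewrite expgS permM h.
move=> u v /porbitP[i ->] /porbitP[j ->] /odd_fix hi /odd_fix hj.
(* Both [(2 i + 1) j] and [(2 j + 1) i] are periods of [t]; they exceed [j] and [i] by the same
   amount [2 i j], which cancels. *)
have := mul_fix _ j hi; rewrite -{2}(mul_fix _ i hj).
have -> : (i.*2.+1 * j = j + (i * j).*2)%N by nia.
have -> : (j.*2.+1 * i = i + (i * j).*2)%N by nia.
by rewrite !expgD !permM => /perm_inj.
Qed.

Section Matchings.
Variables (V E : finType) (ends : E -> {set V}).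
Hypothesis card_ends : forall e, #|ends e| = 2.

Definition is_matching (M : {set E}) : bool :=
  [forall v, #|[set e in M | v \in ends e]| <= 1].

Definition covers (M : {set E}) v := [exists e in M, v \in ends e].

Definition within (K : {set V}) : {set E} := [set e | ends e \subset K].

Lemma matchingP (M : {set E}) :
  reflect (forall e e' v, e \in M -> e' \in M -> v \in ends e -> v \in ends e' ->
             e = e') (is_matching M).
Proof.
apply: (iffP forallP) => [h e e' v eM e'M ve ve'|h v].
  by apply: (card_le1_eqP (h v)); rewrite inE ?eM ?e'M.
apply/card_le1_eqP => e e'; rewrite !inE => /andP[? ?] /andP[? ?].
exact: (h _ _ v).
Qed.

Lemma matching_sub (M N : {set E}) : N \subset M -> is_matching M -> is_matching N.
Proof.
move=> /subsetP NM /matchingP h; apply/matchingP => e e' v eN e'N.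
by apply: h; apply: NM.
Qed.

Lemma matching0 : is_matching set0.
Proof. by apply/matchingP => e e' v; rewrite inE. Qed.

Lemma matching1 e : is_matching [set e].
Proof. by apply/matchingP => a b v; rewrite !inE => /eqP-> /eqP->. Qed.

Lemma card_within_double (M : {set E}) (K : {set V}) :
  (#|M :&: within K|.*2 =
   \sum_(v in K) #|[set e in M :&: within K | v \in ends e]|)%N.
Proof.
transitivity (\sum_(e in M :&: within K) \sum_(v in K) (v \in ends e))%N.
  rewrite -muln2 -sum_nat_const; apply: eq_bigr => e.
  rewrite !inE => /andP[_ /setIidPr eK].
  rewrite -big_mkcondr /= sum1dep_card -(card_ends e) -{1}eK.
  by apply: eq_card => v; rewrite !inE.
rewrite exchange_big /=; apply: eq_bigr => v _.
by rewrite -big_mkcondr /= sum1dep_card; apply: eq_card => e; rewrite !inE.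
Qed.

Lemma card_within_le (M : {set E}) (K : {set V}) : is_matching M ->
  (#|M :&: within K|.*2 <= \sum_(v in K) covers M v)%N.
Proof.
move=> /forallP hM; rewrite card_within_double; apply: leq_sum => v vK.
have [|] := boolP (covers M v) => [_|/exists_inPn nc].
  apply: leq_trans (hM v); apply/subset_leq_card/subsetP => e.
  by rewrite !inE -andbA => /and3P[-> _ ->].
rewrite leqn0 cards_eq0; apply/eqP/setP => e; rewrite !inE.
by apply/negP => /andP[/andP[/nc h _]]; apply/negP.
Qed.

Lemma card_within_ge (M : {set E}) (K : {set V}) :
    (forall e v, e \in M -> v \in ends e -> v \in K -> ends e \subset K) ->
  (\sum_(v in K) covers M v <= #|M :&: within K|.*2)%N.
Proof.
move=> h; rewrite card_within_double; apply: leq_sum => v vK.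
have [/exists_inP[e eM ve]|//] := boolP (covers M v).
by rewrite card_gt0; apply/set0Pn; exists e; rewrite !inE eM (h e v).
Qed.

(** A missed vertex is its own partner, so that the partner map of a matching is an involution whose
    fixed points are the missed vertices. *)
Definition partner (M : {set E}) x :=
  if [pick e in M | x \in ends e] is Some e
  then odflt x [pick y in ends e | y != x] else x.

Lemma partner_uncovered (M : {set E}) x : ~~ covers M x -> partner M x = x.
Proof.
move=> /exists_inPn nc; rewrite /partner; case: pickP => // e /andP[eM xe].
by have := nc e eM; rewrite xe.
Qed.

Lemma partner_edge (M : {set E}) e x y : is_matching M -> e \in M ->
  x \in ends e -> y \in ends e -> x != y -> partner M x = y.
Proof.
move=> /matchingP hM eM xe ye xy; rewrite /partner.
case: pickP => [e' /andP[e'M xe']|/(_ e)]; last by rewrite eM xe.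
rewrite -(hM e e' x) //; case: pickP => [z /andP[ze zx]|/(_ y)] /=; last first.
  by rewrite ye eq_sym xy.
have /cards2P[a [b [_ eab]]] := introT eqP (card_ends e).
apply/eqP; move: xe ye ze xy zx; rewrite eab !inE.
by do 3![case/orP => /eqP ->]; rewrite ?eqxx //= => *.
Qed.

Lemma other_end e x : x \in ends e -> exists2 y, y \in ends e & x != y.
Proof.
move=> xe; have : (0 < #|ends e :\ x|)%N.
  by have := cardsD1 x (ends e); rewrite xe card_ends add1n => -[<-].
by rewrite card_gt0 => /set0Pn[y]; rewrite !inE => /andP[? ?]; exists y;
  rewrite // eq_sym.
Qed.

Lemma partnerK (M : {set E}) : is_matching M -> involutive (partner M).
Proof.
move=> hM x; have [/exists_inP[e eM xe]|nc] := boolP (covers M x).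
  have [y ye xy] := other_end xe.
  rewrite (partner_edge hM eM xe ye xy).
  by apply: (partner_edge hM eM ye xe); rewrite eq_sym.
by rewrite !(partner_uncovered nc).
Qed.

(** For [S] the vertex set of an alternating path, this is the exchange of [M] and [N] along that
    path. *)
Definition swap (S : {set V}) (M N : {set E}) : {set E} :=
  (M :\: within S) :|: (N :&: within S).

Definition edge_closed (S : {set V}) (M : {set E}) :=
  forall e x, e \in M -> x \in ends e -> x \in S -> ends e \subset S.

Lemma partner_closed (S : {set V}) (M : {set E}) : is_matching M ->
  (forall x, x \in S -> partner M x \in S) -> edge_closed S M.
Proof.
move=> hM h e x eM xe xS; apply/subsetP => y ye.
have [<-//|xy] := eqVneq x y.
by rewrite -(partner_edge hM eM xe ye xy); apply: h.
Qed.

Lemma swap_matching (S : {set V}) (M N : {set E}) : is_matching M -> is_matching N ->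
  edge_closed S M -> is_matching (swap S M N).
Proof.
move=> /matchingP hM /matchingP hN cM; apply/matchingP => e e' v.
rewrite !inE => /orP[/andP[neS eM]|/andP[eN eS]] /orP[/andP[neS' eM']|/andP[eN' eS']].
- exact: hM.
- move=> ve ve'; case/negP: neS; apply: (cM e v) => //.
  exact: (subsetP eS').
- move=> ve ve'; case/negP: neS'; apply: (cM e' v) => //.
  exact: (subsetP eS).
- exact: hN.
Qed.

Lemma swap_uncovered_in (S : {set V}) (M N : {set E}) x : edge_closed S M ->
  x \in S -> ~~ covers N x -> ~~ covers (swap S M N) x.
Proof.
move=> cM xS /exists_inPn nc; apply/exists_inPn => e.
rewrite !inE => /orP[/andP[neS eM]|/andP[eN eS]]; last exact: nc.
by apply: contra neS => xe; apply: (cM e x).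
Qed.

Lemma swap_uncovered_out (S : {set V}) (M N : {set E}) x :
  x \notin S -> ~~ covers M x -> ~~ covers (swap S M N) x.
Proof.
move=> xS /exists_inPn nc; apply/exists_inPn => e.
rewrite !inE => /orP[/andP[neS eM]|/andP[eN eS]]; first exact: nc.
by apply: contra xS; apply: (subsetP eS).
Qed.

Local Open Scope ring_scope.
Variable R : realFieldType.
Implicit Types w : E -> R.

Definition weight w (M : {set E}) : R := \sum_(e in M) w e.

Lemma weight_swap w (S : {set V}) (M N : {set E}) :
  weight w (swap S M N) + weight w (swap S N M) = weight w M + weight w N.
Proof.
have sE (A B : {set E}) : weight w (swap S A B) =
    weight w (A :\: within S) + weight w (B :&: within S).
  rewrite /weight [LHS](big_setID (within S)) /= addrC; congr (_ + _); apply: eq_bigl => e;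
  by rewrite !inE; case: (ends e \subset S); rewrite ?(andbF, andbT, orbF).
have split A : weight w A = weight w (A :&: within S) + weight w (A :\: within S).
  exact: big_setID.
by rewrite !sE (split M) (split N); lra.
Qed.

Definition max_matching w (M : {set E}) :=
  is_matching M && [forall N, is_matching N ==> (weight w N <= weight w M)].

Lemma max_matchingP w (M : {set E}) :
  reflect (is_matching M /\ forall N, is_matching N -> weight w N <= weight w M)
          (max_matching w M).
Proof.
apply: (iffP andP) => -[hM h]; split => //.
  by move=> N hN; apply: (implyP (forallP h N)).
by apply/forallP => N; apply/implyP => hN; apply: h.
Qed.

Lemma ex_max_matching w : exists M, max_matching w M.
Proof.
case: (@arg_maxP _ R _ set0 is_matching (weight w) matching0) => M hM h.
by exists M; apply/max_matchingP.
Qed.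

(** [swap S M N] and [swap S N M] are matchings whose weights sum to twice the maximum, so each
    attains it. *)
Lemma swap_max w (S : {set V}) (M N : {set E}) : max_matching w M -> max_matching w N ->
  edge_closed S M -> edge_closed S N -> max_matching w (swap S M N).
Proof.
move=> /max_matchingP[hM mM] /max_matchingP[hN mN] cM cN.
apply/max_matchingP; split; first exact: swap_matching.
move=> L hL; have := mM _ (swap_matching hN hM cN).
have := mM _ hL; have := mM _ hN; have := mN _ hM.
by have := weight_swap w S M N; lra.
Qed.

(** * Gallai's lemma and tight odd sets *)

Section Gallai.
Variable w : E -> R.
Hypothesis missed : forall v, exists2 M, max_matching w M & ~~ covers M v.

(** The disjunct [u == v] makes the relation reflexive although every vertex is missed by some
    maximal matching; Gallai's lemma makes it an equivalence. *)
Definition jointly_covered u v :=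
  (u == v) || [forall M, max_matching w M ==> (covers M u || covers M v)].

Lemma jointly_coveredP u v : reflect
  (u <> v -> forall M, max_matching w M -> ~~ covers M u -> covers M v)
  (jointly_covered u v).
Proof.
rewrite /jointly_covered; have [->|uv] /= := eqVneq u v; first by constructor.
apply: (iffP forallP) => [h _ M mM nu|h M].
  by have := implyP (h M) mM; rewrite (negbTE nu).
apply/implyP => mM; have [//|nu /=] := boolP (covers M u).
by apply: h => //; apply/eqP.
Qed.

Lemma jointly_covered_sym u v : jointly_covered u v -> jointly_covered v u.
Proof.
rewrite /jointly_covered eq_sym; case: eqP => //= _ /forallP h.
by apply/forallP => M; rewrite orbC.
Qed.

(* Gallai's lemma.  If [M] misses [u] and [v] and [N] misses [t], exchanging [M]
   and [N] along the alternating path starting at [t] yields a maximal matching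
   that misses [t] and one of [u], [v], because that path has only one other
   end. *)
Lemma jointly_covered_trans u t v :
  jointly_covered u t -> jointly_covered t v -> jointly_covered u v.
Proof.
move=> ut tv; have [->//|nut] := eqVneq u t.
have [<-//|ntv] := eqVneq t v.
apply/jointly_coveredP => uv M mM nu; apply: contraT => nv.
have [N mN nt] := missed t.
have hM := (max_matchingP _ _ mM).1; have hN := (max_matchingP _ _ mN).1.
have [S [tS fS gS inj]] := dihedral_orbit (partnerK hM) (partnerK hN)
  (partner_uncovered nt).
have cM := partner_closed hM fS; have cN := partner_closed hN gS.
have mS := swap_max mM mN cM cN; have nt' := swap_uncovered_in cM tS nt.
have [uS|uS] := boolP (u \in S); last first.
  case/negP: (swap_uncovered_out N uS nu).
  by apply: (jointly_coveredP _ _ (jointly_covered_sym ut)) mS nt'; apply/eqP; rewrite eq_sym.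
have [vS|vS] := boolP (v \in S).
  by case: uv; apply: inj => //; apply: partner_uncovered.
case/negP: (swap_uncovered_out N vS nv).
by apply: (jointly_coveredP _ _ tv) mS nt'; apply/eqP.
Qed.

(** A maximal matching missing both ends of [e] could be enlarged by [e] to a heavier one. *)
Lemma jointly_covered_edge e u v :
  0 < w e -> u \in ends e -> v \in ends e -> jointly_covered u v.
Proof.
move=> we ue ve; apply/jointly_coveredP => /eqP uv M /max_matchingP[hM mM] nu.
apply: contraT => nv.
have touch a : a \in ends e -> ~~ covers M a.
  have /cards2P[x [y [_ exy]]] := introT eqP (card_ends e).
  move=> ae; move: ue ve ae uv nu nv; rewrite exy !inE.
  by do 3![case/orP => /eqP ->]; rewrite ?eqxx //= => *.
have eM : e \notin M.
  by apply: contra nu => eM; apply/exists_inP; exists e.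
have : is_matching (e |: M).
  apply/matchingP => a b x; rewrite !inE => /orP[/eqP->|aM] /orP[/eqP->|bM] // xa xb.
  - by case/negP: (touch _ xa); apply/exists_inP; exists b.
  - by case/negP: (touch _ xb); apply/exists_inP; exists a.
  - exact: (matchingP _ hM a b x).
by move=> /mM; rewrite {1}/weight big_setU1 //= -/(weight w M); lra.
Qed.

(** [K] is the class of an end [u] of [e] under joint coverage. No maximal matching misses two
    vertices of [K], and edges of positive weight do not leave [K]; this bounds from below the
    number of matching edges inside [K]. *)
Lemma tight_odd_set e : (forall e, 0 <= w e) -> 0 < w e ->
  exists2 K : {set V}, (1 < #|K|)%N &
    forall M, max_matching w M -> (#|M :&: within K|.*2.+1)%N = #|K|.
Proof.
move=> w0 we; have : (0 < #|ends e|)%N by rewrite card_ends.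
rewrite card_gt0 => /set0Pn[u ue].
pose K := [set v | jointly_covered u v]; exists K.
  rewrite -(card_ends e); apply/subset_leq_card/subsetP => v ve; rewrite inE.
  exact: jointly_covered_edge we ue ve.
have uK : u \in K by rewrite inE; apply/jointly_coveredP.
have lower M : max_matching w M -> (#|K| <= #|M :&: within K|.*2.+1)%N.
  (* Dropping the edges of weight zero keeps the matching maximal and leaves only edges that stay
     inside a class. *)
  move=> /max_matchingP[hM mM]; pose M0 := [set e in M | 0 < w e].
  have M0M : M0 \subset M by apply/subsetP => a; rewrite inE => /andP[].
  have mM0 : max_matching w M0.
    apply/max_matchingP; split=> [|N /mM]; first exact: matching_sub hM.
    suff -> : weight w M = weight w M0 by [].
    rewrite /weight (big_setID M0) /= [X in _ + X]big1 ?addr0.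
      by apply: eq_bigl => a; rewrite !inE andbA andbb.
    move=> a; rewrite !inE => /andP[/nandP[na aM|]]; first by rewrite aM in na.
    by rewrite lt_neqAle w0 andbT negbK => /eqP.
  have : (\sum_(v in K) covers M0 v <= #|M0 :&: within K|.*2)%N.
    apply: card_within_ge => a x; rewrite !inE => /andP[aM wa] xa ux.
    apply/subsetP => y ya; rewrite inE.
    exact: jointly_covered_trans ux (jointly_covered_edge wa xa ya).
  have : (#|M0 :&: within K| <= #|M :&: within K|)%N.
    by apply/subset_leq_card/setSI.
  suff : (#|K| <= (\sum_(v in K) covers M0 v).+1)%N by lia.
  have [/existsP[z /andP[zK nz]]|] := boolP [exists v in K, ~~ covers M0 v]; last first.
    rewrite negb_exists_in => /forall_inP h; rewrite -sum1_card leqW //.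
    by apply: leq_sum => v /h; rewrite negbK => ->.
  rewrite -sum1_card (bigD1 z) //= add1n ltnS [leqRHS](bigD1 z) //= -[leqLHS]add0n.
  apply: leq_add => //; apply: leq_sum => v /andP[vK vz].
  rewrite lt0b.
  have zv : jointly_covered z v.
    move: zK vK; rewrite !inE => /jointly_covered_sym; exact: jointly_covered_trans.
  by apply: (jointly_coveredP _ _ zv) mM0 nz; apply/eqP; rewrite eq_sym.
have [N mN nu] := missed u.
have NK : (#|N :&: within K|.*2 < #|K|)%N.
  have hN := (max_matchingP _ _ mN).1.
  apply: leq_ltn_trans (card_within_le K hN) _.
  rewrite (bigD1 u) //= (negbTE nu) add0n (cardsD1 u K) uK add1n ltnS -sum1_card.
  by rewrite [leqRHS](eq_bigl (fun v => (v \in K) && (v != u)));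
    [apply: leq_sum => v _; case: covers | move=> v; rewrite !inE andbC].
(* As [N] misses [u], [#|K|] is exactly [2 n + 1], with [n] the number of edges of [N] inside [K];
   the bounds for [M] then force the same number. *)
move=> M mM; have := lower _ mM; have := lower _ mN.
have hM := (max_matchingP _ _ mM).1.
have := card_within_le K hM.
have : (\sum_(v in K) covers M v <= #|K|)%N.
  by rewrite -sum1_card; apply: leq_sum => v _; case: covers.
lia.
Qed.

End Gallai.

End Matchings.

(** * Edmonds' inequalities *)

Section Edmonds.
Variables (V E : finType) (ends : E -> {set V}).
Hypothesis card_ends : forall e, #|ends e| = 2.
Local Open Scope ring_scope.
Variable R : realFieldType.
Implicit Types w y : E -> R.

(** For odd [K] the last condition is Edmonds' [y(E[K]) <= (|K| - 1) / 2]. Imposed on even [K] as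
    well, it is stronger than membership in the matching polytope, but half a point of the spanning
    tree polytope satisfies it. *)
Definition edmonds_feasible y :=
  [/\ forall e, 0 <= y e,
      forall v, \sum_(e | v \in ends e) y e <= 1 &
      forall K : {set V}, (1 < #|K|)%N ->
        2 * (\sum_(e in within ends K) y e) + 1 <= #|K|%:R].

Lemma weight_indicator (A M : {set E}) :
  weight (fun e => (e \in A)%:R) M = #|M :&: A|%:R :> R.
Proof.
by rewrite /weight -natr_sum -big_mkcondr /= sum1dep_card; congr (_%:R);
  apply: eq_card => e; rewrite !inE.
Qed.

Lemma sum_indicator (A : {set E}) y :
  \sum_e (e \in A)%:R * y e = \sum_(e in A) y e.
Proof.
by rewrite [RHS]big_mkcond; apply: eq_bigr => e _; case: ifP; rewrite ?mul1r ?mul0r.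
Qed.

(* The face of a nonzero objective [w] lies in the face of one of Edmonds'
   inequalities, here written [a . y <= b]. *)
Lemma tight_inequality w : (exists e, w e != 0) ->
  exists a : E -> R, exists b : R,
    [/\ forall M, is_matching ends M -> weight a M <= b,
        exists2 N, is_matching ends N & weight a N < b,
        forall M, max_matching ends w M -> weight a M = b &
        forall y, edmonds_feasible y -> \sum_e a e * y e <= b].
Proof.
move=> [e0 we0].
have weight0 a : weight a (set0 : {set E}) = 0 :> R by rewrite /weight big_set0.
(* An edge of negative weight lies in no maximal matching, so [- y e <= 0] is tight. *)
have [/existsP[e we]|] := boolP [exists e, w e < 0].
  exists (fun a => - (a \in [set e])%:R), 0.
  have wE M : weight (fun a => - (a \in [set e])%:R) M = - #|M :&: [set e]|%:R :> R.
    by rewrite -weight_indicator /weight sumrN.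
  split=> [M _||M /max_matchingP[hM mM]|y [y0 _ _]].
  - by rewrite wE oppr_le0.
  - by exists [set e]; [exact: matching1 | rewrite wE setIid cards1 oppr_lt0].
  - rewrite wE; suff /setP -> : M :&: [set e] =i set0 by rewrite cards0 oppr0.
    move=> a; rewrite !inE; apply/negP => /andP[aM /eqP ae]; subst a.
    have := mM _ (matching_sub (subsetDl M [set e]) hM).
    by rewrite [X in _ <= X]/weight (big_setD1 e) //= -/(weight _ _); lra.
  - under eq_bigr do rewrite mulNr.
    by rewrite sumrN sum_indicator big_set1 oppr_le0.
rewrite negb_exists => /forallP w0; have {}w0 e : 0 <= w e by rewrite leNgt.
(* A vertex covered by all maximal matchings makes its degree inequality tight. *)
have [/existsP[v /forallP cv]|] :=
  boolP [exists v, [forall M, max_matching ends w M ==> covers ends M v]].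
  exists (fun a => (a \in [set e | v \in ends e])%:R), 1.
  split=> [M hM||M mM|y [_ yv _]].
  - rewrite weight_indicator lern1.
    move/forallP/(_ v): hM; apply: leq_trans.
    by apply/subset_leq_card/subsetP => e; rewrite !inE.
  - by exists set0; rewrite ?matching0 // weight0.
  - rewrite weight_indicator; suff -> : #|M :&: [set e | v \in ends e]| = 1%N by [].
    have [hM _] := max_matchingP _ _ _ mM.
    apply/eqP; rewrite eqn_leq; apply/andP; split.
      move/forallP/(_ v): hM; apply: leq_trans.
      by apply/subset_leq_card/subsetP => e; rewrite !inE.
    have /exists_inP[e eM ve] := implyP (cv M) mM.
    by rewrite card_gt0; apply/set0Pn; exists e; rewrite !inE eM.
  - by rewrite sum_indicator; under eq_bigl do rewrite inE.
(* Now every vertex is missed by some maximal matching, which is the hypothesis of Gallai's lemma;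
   it supplies a tight odd set. *)
rewrite negb_exists => /forallP missed.
have {}missed v : exists2 M, max_matching ends w M & ~~ covers ends M v.
  have := missed v; rewrite negb_forall => /existsP[M]; rewrite negb_imply => /andP[? ?].
  by exists M.
have we : 0 < w e0 by rewrite lt_neqAle eq_sym we0 w0.
have [K K1 tK] := tight_odd_set card_ends missed w0 we.
have [M0 mM0] := ex_max_matching ends w.
pose k := #|M0 :&: within ends K|.
have KE : #|K| = k.*2.+1 by rewrite tK.
exists (fun a => (a \in within ends K)%:R), k%:R.
split=> [M hM||M mM|y [_ _ yK]].
- rewrite weight_indicator ler_nat.
  have := card_within_le card_ends K hM.
  have : (\sum_(v in K) covers ends M v <= #|K|)%N.
    by rewrite -sum1_card; apply: leq_sum => v _; case: covers.
  by rewrite KE; lia.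
- exists set0; rewrite ?matching0 // weight0 ltr0n.
  by move: K1; rewrite KE; lia.
- by rewrite weight_indicator; congr (_%:R); have := tK M mM; rewrite KE; lia.
- rewrite sum_indicator; have := yK _ K1; rewrite KE.
  have -> : (k.*2.+1)%:R = 2 * k%:R + 1 :> R by rewrite -natr1 -mul2n natrM.
  by lra.
Qed.

(* Subtracting a multiple of the tight inequality from the objective, until a
   further matching becomes maximal, keeps the old maximal matchings and only
   strengthens the claim. *)
Lemma edmonds_dual y : edmonds_feasible y ->
  forall w M, max_matching ends w M -> \sum_e w e * y e <= weight w M.
Proof.
move=> hy w.
have [n] := ubnP #|[set M | is_matching ends M & ~~ max_matching ends w M]|.
elim: n w => // n IH w ltn M mM.
have [/existsP/tight_inequality[a [b [ab [N0 hN0 aN0] aM ay]]]|] :=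
    boolP [exists e, w e != 0]; last first.
  rewrite negb_exists => /forallP w0.
  have {}w0 e : w e = 0 by apply/eqP; rewrite -[_ == _]negbK.
  rewrite /weight !big1 // => e _; rewrite w0 // mul0r.
  by [].
have [hM wM] := max_matchingP _ _ _ mM.
(* [ratio N] is the multiple of the inequality at which [N] catches up with [M]; stopping at the
   smallest ratio keeps [M] maximal. *)
pose ratio N := (weight w M - weight w N) / (b - weight a N).
pose slack N := is_matching ends N && (weight a N < b).
have slack0 : slack N0 by rewrite /slack hN0.
have [N /andP[hN sN] minN] := @arg_minP _ R _ N0 slack ratio slack0.
pose d := ratio N; pose w' e := w e - d * a e.
have w'E L : weight w' L = weight w L - d * weight a L.
  by rewrite /weight big_split /= sumrN mulr_sumr.
have d0 : 0 <= d by rewrite divr_ge0 // subr_ge0 ?wM // ltW.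
have w'max L : is_matching ends L -> weight w' L <= weight w M - d * b.
  move=> hL; rewrite w'E.
  have := ab L hL; rewrite le_eqVlt => /orP[/eqP ->|sL].
    by rewrite lerD2r wM.
  have := minN L; rewrite /slack hL sL => /(_ isT).
  rewrite -/d ler_pdivlMr ?subr_gt0 // mulrBr => H.
  by lra.
have mM' L : max_matching ends w L -> max_matching ends w' L.
  move=> mL; have [hL wL] := max_matchingP _ _ _ mL.
  apply/max_matchingP; split=> // L' /w'max h; apply: le_trans h _.
  by rewrite w'E (aM _ mL) lerD2r wL.
have mN' : max_matching ends w' N.
  apply/max_matchingP; split=> // L' /w'max h; apply: le_trans h _.
  rewrite w'E.
  have : d * (b - weight a N) = weight w M - weight w N.
    by rewrite /d /ratio divfK // subr_eq0 gt_eqF.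
  by rewrite mulrBr => H; lra.
have nN : ~~ max_matching ends w N.
  by apply: contraL sN => /aM ->; rewrite ltxx.
(* The old maximal matchings stay maximal and [N] joins them, so the induction hypothesis covers
   [w']; since [d] is nonnegative, [a . y <= b] carries the bound back to [w]. *)
have := IH w' _ M (mM' _ mM); rewrite w'E (aM _ mM).
have -> : \sum_e w' e * y e = \sum_e w e * y e - d * (\sum_e a e * y e).
  by rewrite mulr_sumr -sumrB; apply: eq_bigr => e _; rewrite /w' mulrBl mulrA.
have : d * (\sum_e a e * y e) <= d * b by rewrite ler_wpM2l // ay.
move=> h1 h2; have {h2} : \sum_e w e * y e - d * (\sum_e a e * y e) <= weight w M - d * b.
  apply: h2; apply: leq_trans (ltn : (_ <= n)%N); apply/proper_card/properP; split.
    apply/subsetP => L; rewrite !inE => /andP[-> nL] /=.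
    by apply: contra nL; exact: mM'.
  by exists N; rewrite !inE hN ?mN'.
by lra.
Qed.

End Edmonds.

(** * Forests *)

From mathcomp Require Import boolp.

(** In a longest simple path inside [U], all neighbours in [U] of the first vertex [x] lie on the
    path. One of two such neighbours is not the successor of [x], and the edge to it closes a cycle
    of length at least three. *)
Lemma ucycle_of_min_degree2 (V : finType) (e : rel V) (U : {set V}) :
    symmetric e -> irreflexive e -> U != set0 ->
    {in U, forall x, exists y z, [/\ y \in U, z \in U, y != z, e x y & e x z]} ->
  exists2 c : seq V, 2 < size c & ucycle e c.
Proof.
move=> e_sym e_irr /set0Pn[u uU] deg2.
pose P n := [exists s : n.-tuple V, [&& uniq s, all (mem U) s & sorted e s]].
have exP : exists n, P n by exists 1; apply/existsP; exists [tuple u]; rewrite /= uU.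
have ubP n : P n -> n <= #|V|.
  move=> /existsP[s /and3P[us _ _]]; rewrite -(size_tuple s) -(card_uniqP us).
  exact: max_card.
case: (ex_maxnP exP ubP) => n /existsP[s /and3P[us Us es]] maxn.
have n1 : 1 <= n by apply: maxn; apply/existsP; exists [tuple u]; rewrite /= uU.
move: us Us es; case s_eq: (tval s) => [|x p].
  by have := size_tuple s; rewrite s_eq => n0; rewrite -n0 in n1.
have sp : size p = n.-1 by have := size_tuple s; rewrite s_eq => <-.
move=> /= /andP[xp up] /andP[xU pU] ep.
have nbr y : y \in U -> e x y -> y \in p.
  move=> yU exy; apply: contraT => yp.
  have : P n.+1.
    have sz : size [:: y, x & p] == n.+1 by rewrite /= sp prednK.
    apply/existsP; exists (Tuple sz) => /=; rewrite !inE negb_or yp xp up yU xU pU ep.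
    by rewrite e_sym exy !andbT /=; apply: contraTneq exy => ->; rewrite e_irr.
  by move/maxn; rewrite ltnn.
have cyc y : y \in p -> y != head x p -> e x y ->
    exists2 c : seq V, 2 < size c & ucycle e c.
  have ux : uniq (x :: p) by rewrite /= xp.
  move=> yp; case/splitPr: yp ux ep => [[|a p1] p2]; first by rewrite /= eqxx.
  rewrite -cat_rcons -cat_cons cat_uniq cat_path => /andP[ux _] /andP[ep _] _ exy.
  exists (x :: rcons (a :: p1) y); first by rewrite /= size_rcons.
  by rewrite /ucycle ux andbT [path.cycle _ _]rcons_path ep last_rcons e_sym.
have [y [z [yU zU yz exy exz]]] := deg2 x xU.
have [yh|yh] := eqVneq y (head x p); last exact: cyc (nbr _ yU exy) yh exy.
by apply: cyc (nbr _ zU exz) _ exz; rewrite -yh eq_sym.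
Qed.

Section Forests.
Variables (V : finType) (adj : rel V).
Hypothesis adj_irr : irreflexive adj.

Lemma card_edge (e : edge adj) : #|val e| = 2.
Proof.
have /existsP[u /existsP[v /andP[uv /eqP ->]]] := valP e.
by rewrite cards2; case: eqVneq uv => // ->; rewrite adj_irr.
Qed.

Lemma joined_in_sym (A : {set edge adj}) : symmetric (joined_in A).
Proof. by move=> u v; apply/eq_existsb => e; rewrite finset.setUC. Qed.

Lemma joined_in_irr (A : {set edge adj}) : irreflexive (joined_in A).
Proof.
move=> u; apply/negbTE/exists_inPn => e _; apply/eqP => eu.
by have := card_edge e; rewrite eu finset.setUid cards1.
Qed.

(** Otherwise each vertex of [U] has two edges of [A] inside [U]; the graph being simple, their
    other ends differ, and a cycle exists. *)
Lemma acyclic_leaf (A : {set edge adj}) (U : {set V}) : acyclic A -> U != finset.set0 ->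
  exists2 x, x \in U & #|[set e in A :&: within val U | x \in val e]%SET| <= 1.
Proof.
move=> acA U0.
have [/exists_inP[x xU dx]|] :=
  boolP [exists x in U, #|[set e in A :&: within val U | x \in val e]%SET| <= 1].
  by exists x.
move=> /exists_inPn deg; case: acA.
apply: ucycle_of_min_degree2 (@joined_in_sym A) (@joined_in_irr A) U0 _ => x xU.
have := deg x xU; rewrite -ltnNge => /card_gt1P[e [e' []]].
have ends2 (a : edge adj) : x \in val a ->
    exists2 y, val a = [set x; y]%SET & x != y.
  move=> xa; have [y ya xy] := other_end card_edge xa; exists y => //.
  apply/esym/eqP; rewrite eqEcard cards2 xy card_edge andbT.
  by apply/subsetP => z /set2P[] ->.
rewrite !inE => /andP[/andP[eA eU] /ends2[y ey xy]] /andP[/andP[eA' eU'] /ends2[z ez xz]].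
move=> ee'; exists y, z; split.
- by apply: (subsetP eU); rewrite ey !inE eqxx orbT.
- by apply: (subsetP eU'); rewrite ez !inE eqxx orbT.
- by apply: contra ee' => /eqP yz; apply/eqP/val_inj; rewrite /= ey ez yz.
- by apply/exists_inP; exists e; rewrite ?ey.
- by apply/exists_inP; exists e'; rewrite ?ez.
Qed.

(** Induction on [U]: removing a vertex that is a leaf or isolated loses at most one edge. *)
Lemma card_acyclic_within (A : {set edge adj}) (U : {set V}) :
  acyclic A -> 0 < #|U| -> #|A :&: within val U| < #|U|.
Proof.
move=> acA; have [n] := ubnP #|U|; elim: n U => // n IH U ltn U0.
have [|x xU dx] := acyclic_leaf acA (U := U); first by rewrite -card_gt0.
have UE := cardsD1 x U; rewrite xU add1n in UE.
pose B := [set e in A :&: within val U | x \in val e]%SET.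
have sub : A :&: within val U \subset (A :&: within val (U :\ x)) :|: B.
  apply/subsetP => e; rewrite !inE subsetD1 => /andP[-> ->] /=.
  by case: (x \in val e).
have le : #|A :&: within val U| <= #|A :&: within val (U :\ x)| + 1.
  apply: leq_trans (subset_leq_card sub) _; apply: leq_trans (leq_card_setU _ _) _.
  by rewrite leq_add2l.
(* For a singleton [U] the count is zero, as an edge has two ends. *)
have [U1|U1] := posnP #|U :\ x|; last first.
  by have := IH (U :\ x); lia.
suff -> : A :&: within val U = finset.set0 by rewrite cards0.
apply/setP => e; rewrite !inE; apply/negP => /andP[_ /subset_leq_card].
by rewrite card_edge UE U1.
Qed.

Lemma ex_spanning_tree : exists T, spanning_tree (adj := adj) T.
Proof.
have ac0 : acyclic (finset.set0 : {set edge adj}).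
  case=> -[|x [|y c]] // _ /andP[] /=; case: c => [|z c] /andP[/exists_inP[e]].
    by rewrite inE.
  by rewrite inE.
have [T mT _] := @maxset_exists _ (fun A => `[< @acyclic V adj A >]) _ (asboolT ac0).
by exists T.
Qed.

Lemma spanning_tree_acyclic (T : {set edge adj}) : spanning_tree T -> acyclic T.
Proof. by move=> /maxsetp /asboolP. Qed.

End Forests.

(** * Maximal entropy *)

From mathcomp Require Import all_classical all_reals interval_inference.
From mathcomp Require Import topology normedtype convex sequences.
From mathcomp Require Import derive exp realfun.
Import numFieldNormedType.Exports.

Local Open Scope classical_set_scope.
Local Open Scope ring_scope.

(** * The linear map [comb] and its kernel *)

Section Combinations.
Variables (R : realType) (I J : finType) (a : I -> J -> R).

Definition comb (l : I -> R) (j : J) : R := \sum_i l i * a i j.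

Lemma combD l m j : comb (fun i => l i + m i) j = comb l j + comb m j.
Proof. by rewrite -big_split; apply: eq_bigr => i _; rewrite mulrDl. Qed.

Lemma combZ (t : R) l j : comb (fun i => t * l i) j = t * comb l j.
Proof. by rewrite mulr_sumr; apply: eq_bigr => i _; rewrite mulrA. Qed.

Lemma comb_delta i j : comb (fun i' => (i' == i)%:R) j = a i j.
Proof.
rewrite /comb (bigD1 i) //= eqxx mul1r big1 ?addr0 // => i' /negbTE ->.
by rewrite mul0r.
Qed.

(** A generalised inverse of the matrix [a] chooses, linearly, a preimage of each point in the image
    of [comb]. *)
Lemma comb_section : exists C : J -> I -> R, forall mu,
  comb (fun i => \sum_j comb mu j * C j i) =1 comb mu.
Proof.
pose A : 'M[R]_(#|I|, #|J|) := \matrix_(i, j) a (enum_val i) (enum_val j).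
exists (fun j i => pinvmx A (enum_rank j) (enum_rank i)) => mu j.
pose m : 'rV[R]_#|I| := \row_i mu (enum_val i).
have reI (F : I -> R) : \sum_i F i = \sum_(i < #|I|) F (enum_val i).
  by rewrite (reindex_onto enum_val enum_rank) //= => [|i _];
    [apply: eq_bigl => i; rewrite enum_valK eqxx | rewrite enum_rankK].
have reJ (F : J -> R) : \sum_i F i = \sum_(i < #|J|) F (enum_val i).
  by rewrite (reindex_onto enum_val enum_rank) //= => [|i _];
    [apply: eq_bigl => i; rewrite enum_valK eqxx | rewrite enum_rankK].
have mE k : (m *m A) 0 k = comb mu (enum_val k).
  by rewrite mxE /comb reI; apply: eq_bigr => i _; rewrite !mxE.
have /matrixP/(_ 0 (enum_rank j)) := mulmxKpV (submxMl m A).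
rewrite mE enum_rankK => <-; rewrite mxE /comb reI; apply: eq_bigr => i _.
rewrite [X in _ = X * _]mxE [A _ _]mxE enum_rankK; congr (_ * _); rewrite reJ.
by apply: eq_bigr => k _; rewrite mE !enum_valK.
Qed.

(** The orthogonal complement of the kernel is the image of the transpose. A basis vector minus the
    section's preimage of its image lies in the kernel; pairing it with [l] expresses [l i] through
    the row [a i]. *)
Lemma orthogonal_comb_kernel (l : I -> R) :
    (forall mu, (forall j, comb mu j = 0) -> \sum_i mu i * l i = 0) ->
  exists theta : J -> R, forall i, l i = \sum_j theta j * a i j.
Proof.
move=> orth; have [C HC] := comb_section.
exists (fun j => \sum_i C j i * l i) => i.
pose mu i' : R := (i' == i)%:R.
pose mu' i' := \sum_j comb mu j * C j i'.
have /orth : forall j, comb (fun i => mu i + -1 * mu' i) j = 0.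
  by move=> j; rewrite combD combZ HC mulN1r subrr.
under eq_bigr do rewrite mulrDl mulN1r mulNr.
rewrite sumrB => /eqP; rewrite subr_eq0 => /eqP.
rewrite (bigD1 i) //= /mu eqxx mul1r big1 ?addr0; last first.
  by move=> i' /negbTE ->; rewrite mul0r.
move=> ->; under eq_bigr do rewrite /mu' mulr_suml.
rewrite exchange_big /=; apply: eq_bigr => j _.
rewrite mulr_suml; apply: eq_bigr => i' _.
by rewrite comb_delta mulrC mulrA mulrC -mulrA.
Qed.

End Combinations.

(** * The function [x ln x] and compactness in [R^I] *)

Section Analysis.
Variable R : realType.

(** The left side is the tangent of [x ln x] at [m]; the inequality is [ln (m / x) <= m / x - 1]
    multiplied by [x]. *)
Lemma xlnx_tangent (x m : R) : 0 <= x -> 0 < m -> x * ln m + x - m <= x * ln x.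
Proof.
rewrite le_eqVlt => /orP[/eqP <-|x0] m0; first by rewrite !mul0r add0r sub0r oppr_le0 ltW.
have mx : 0 < m / x by rewrite divr_gt0.
have : ln (1 + (m / x - 1)) <= m / x - 1 by apply: le_ln1Dx; lra.
rewrite addrC subrK ln_div ?posrE // => /(ler_wpM2l (ltW x0)).
rewrite !mulrBr mulr1 mulrCA divff ?gt_eqF // mulr1.
by lra.
Qed.

(** Average the tangent inequalities at the mean [m], which is positive because [z] is. *)
Lemma xlnx_convex (x z t : R) : 0 <= x -> 0 < z -> 0 < t < 1 ->
  ((1 - t) * x + t * z) * ln ((1 - t) * x + t * z) <=
  (1 - t) * (x * ln x) + t * (z * ln z).
Proof.
move=> x0 z0 /andP[t0 t1]; set m := _ + _.
have m0 : 0 < m.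
  rewrite /m; have : 0 < t * z by rewrite mulr_gt0.
  have : 0 <= (1 - t) * x by rewrite mulr_ge0 // subr_ge0 ltW.
  by lra.
have t1' : 0 <= 1 - t by lra.
have := ler_wpM2l t1' (xlnx_tangent x0 m0).
have := ler_wpM2l (ltW t0) (xlnx_tangent (ltW z0) m0).
have -> : m * ln m = (1 - t) * (x * ln m + x - m) + t * (z * ln m + z - m).
  by rewrite /m; ring.
by lra.
Qed.

Lemma continuous_xlnx : continuous (fun x : R => x * ln x).
Proof.
(* With [s] the square root of [x > 0], the tangent at [1] gives [s ln s >= s - 1], so
   [x ln x >= 2 s (s - 1) >= - 2 s]. This squeezes the function at [0]. *)
have lower (x : R) : - (2 * Num.sqrt `|x|) <= x * ln x.
  have [x0|x0] := leP x 0.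
    by rewrite ln0 // mulr0 oppr_le0 mulr_ge0 // sqrtr_ge0.
  rewrite gtr0_norm // -{2 3}(sqr_sqrtr (ltW x0)); set s := Num.sqrt x.
  have s0 : 0 < s by rewrite sqrtr_gt0.
  rewrite lnXn // -mulr_natl.
  have := xlnx_tangent (ltW s0) (@ltr01 R); rewrite ln1 mulr0 add0r => h.
  by nra.
move=> x; have [x0|x0|->] := ltrgt0P x.
- exact: cvgM (@cvg_id _ _) (continuous_ln x0).
- rewrite /continuous_at ln0 ?ltW // mulr0.
  apply: cvg_trans (@cvg_cst _ (0 : R) _ (nbhs x) _); apply: near_eq_cvg.
  near=> y; rewrite ln0 ?mulr0 // ltW //; near: y; exact: lt_nbhsl.
- rewrite /continuous_at mul0r.
  apply: (@squeeze_cvgr _ _ _ _ (fun x : R => - (2 * Num.sqrt `|x|)) (cst 0)).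
  + near=> y; rewrite lower /=.
    have [y0|y0] := leP y 0; first by rewrite ln0 // mulr0.
    apply: mulr_ge0_le0; [exact: ltW|apply: ln_le0; apply: ltW].
    by near: y; exact: lt_nbhsl.
  + suff : - (2 * Num.sqrt `|x|) @[x --> (0 : R)] --> - (2 * Num.sqrt `|0 : R|).
      by rewrite normr0 sqrtr0 mulr0 oppr0.
    apply: cvgN; apply: cvgM; first exact: cvg_cst.
    by apply: continuous_comp; [exact: norm_continuous | exact: sqrt_continuous].
  + exact: cvg_cst.
Unshelve. all: by end_near.
Qed.

Lemma sum_continuous (T : topologicalType) (I : finType) (f : I -> T -> R) :
  (forall i, continuous (f i)) -> continuous (fun x => \sum_i f i x).
Proof.
move=> cf; apply: (@continuous_big R I +%R 0 xpredT _ T (index_enum I) f) => [|i _ x].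
  exact: add_continuous.
exact: cf.
Qed.

Lemma coord_continuous (I : finType) (i : I) (g : R -> R) : continuous g ->
  continuous (fun l : {ptws I -> R} => g (l i)).
Proof.
move=> cg l; apply: continuous_comp (cg (l i)).
exact: (@proj_continuous I (fun=> R) i l).
Qed.

Lemma ptws_cvg (T : Type) (F : set_system T) (I : Type) (f : T -> {ptws I -> R})
    (l : {ptws I -> R}) : Filter F ->
  (forall i, f x i @[x --> F] --> l i) -> f x @[x --> F] --> l.
Proof.
move=> FF h; apply/cvg_sup => i U [_ [[W oW <-] /= Wl WU]].
have := h i W (open_nbhs_nbhs (conj oW Wl)).
move=> hW; change (F (fun x => U (f x))).
exact: (@filterS _ F FF _ _ (fun x => WU (f x)) hW).
Qed.

Lemma bounded_closed_min (I : finType) (A : set {ptws I -> R}) (B : R)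
    (f : {ptws I -> R} -> R) :
    A !=set0 -> closed A -> (forall l, A l -> forall i, 0 <= l i <= B) ->
    continuous f ->
  exists2 l, A l & forall m, A m -> f l <= f m.
Proof.
move=> A0 cA bA cf.
have kB : compact [set l : {ptws I -> R} | forall i, [set` `[0, B]] (l i)].
  apply: (@tychonoff I (fun=> R) (fun=> [set` `[0, B]])) => i.
  exact: segment_compact.
have kA : compact A.
  by apply: (subclosed_compact cA kB) => l /bA h i /=; rewrite in_itv /= h.
have [|l lA lmin] := compact_EVT_min A0 kA (f := f).
  exact: continuous_subspaceT.
by exists l; [rewrite inE in lA | move=> m mA; apply: lmin; rewrite inE].
Qed.

End Analysis.

(** * Entropy on the fibres of [comb] *)

Section Gibbs.
Variables (R : realType) (I J : finType) (a : I -> J -> R).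

Lemma comb_continuous j : continuous (fun l : {ptws I -> R} => comb a l j).
Proof.
apply: sum_continuous => i; apply: (@coord_continuous R I i (fun x => x * a i j)).
by move=> x; apply: cvgM; [exact: cvg_id | exact: cvg_cst].
Qed.

Lemma closed_comb_fiber (x : J -> R) :
  closed [set l : {ptws I -> R} | (forall i, 0 <= l i) /\ comb a l =1 x].
Proof.
have -> : [set l : {ptws I -> R} | (forall i, 0 <= l i) /\ comb a l =1 x] =
    \bigcap_(i in setT) ((fun l : {ptws I -> R} => l i) @^-1` [set y | 0 <= y]) `&`
    \bigcap_(j in setT) ((fun l : {ptws I -> R} => comb a l j) @^-1` [set y | y = x j]).
  apply/seteqP; split=> l /=.
    by move=> [l0 lx]; split=> [i _|j _] //=; exact: lx.
  by move=> [l0 lx]; split=> [i|j]; [exact: (l0 i) | exact: (lx j)].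
apply: closedI; apply: closed_bigI => k _; apply: closed_comp.
- by move=> l _; exact: (@proj_continuous I (fun=> R) k l).
- exact: closed_ge.
- by move=> l _; exact: comb_continuous.
- exact: closed_eq.
Qed.

(** The column [j0] of ones fixes the total mass on each fibre of [comb a], which bounds its
    nonnegative points and makes them a compact set. *)
Variables (j0 : J).
Hypothesis a_j0 : forall i, a i j0 = 1.

Lemma comb_one l : comb a l j0 = \sum_i l i.
Proof. by apply: eq_bigr => i _; rewrite a_j0 mulr1. Qed.

Lemma comb_fiber_min (x : J -> R) (f : {ptws I -> R} -> R) (l0 : I -> R) :
    (forall i, 0 <= l0 i) -> comb a l0 =1 x -> continuous f ->
  exists l : I -> R, [/\ forall i, 0 <= l i, comb a l =1 x &
    forall m : I -> R, (forall i, 0 <= m i) -> comb a m =1 x -> f l <= f m].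
Proof.
move=> l0_ge0 l0x cf.
have [||l [l_ge0 lx] lmin] :=
    bounded_closed_min (B := x j0) _ (closed_comb_fiber (x := x)) _ cf.
- by exists l0.
- move=> l [l_ge0 lx] i; rewrite l_ge0 -lx comb_one (bigD1 i) //= lerDl.
  by apply: sumr_ge0.
by exists l; split=> // m m_ge0 mx; apply: lmin.
Qed.

Definition negentropy (l : I -> R) := \sum_i l i * ln (l i).

(* Moving from a minimiser [l] with [l k = 0] towards the positive point [l0]
   changes the negative entropy by at most [O(t) + t l0(k) ln t], which is
   negative for small [t]. *)
Lemma negentropy_min_gt0 (l l0 : I -> R) :
    (forall i, 0 <= l i) -> (forall i, 0 < l0 i) ->
    (forall t, 0 < t < 1 ->
       negentropy l <= negentropy (fun i => (1 - t) * l i + t * l0 i)) ->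
  forall i, 0 < l i.
Proof.
move=> l_ge0 l0_gt0 lmin k; rewrite lt_neqAle l_ge0 andbT; apply/negP => /eqP lk.
pose D := negentropy l0 - negentropy l.
(* With [t = exp (- c)], the term [t l0(k) ln t] equals [- t (|D| + 1)], which outweighs the change
   [t D] allowed by convexity. *)
pose c := (`|D| + 1) / l0 k.
have c0 : 0 < c by rewrite divr_gt0 // ltr_wpDl.
pose t := expR (- c).
have t01 : 0 < t < 1 by rewrite expR_gt0 expR_lt1 oppr_lt0.
have [t0 t1] := andP t01.
have term i : ((1 - t) * l i + t * l0 i) * ln ((1 - t) * l i + t * l0 i) <=
    (1 - t) * (l i * ln (l i)) + t * (l0 i * ln (l0 i)) +
    (if i == k then - t * l0 k * c else 0).
  case: eqVneq => [->|_]; last by rewrite addr0; exact: xlnx_convex.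
  rewrite -lk mul0r !mulr0 !add0r lnM ?posrE // /t expRK.
  by rewrite le_eqVlt; apply/orP; left; apply/eqP; ring.
have : negentropy l <= (1 - t) * negentropy l + t * negentropy l0 + - t * l0 k * c.
  apply: le_trans (lmin t t01) _; apply: le_trans (ler_sum _ (fun i _ => term i)) _.
  by rewrite !big_split /= -!mulr_sumr -big_mkcond big_pred1_eq.
have -> : - t * l0 k * c = - t * (`|D| + 1).
  by rewrite -mulrA [l0 k * c]mulrC divfK // gt_eqF.
have := ler_wpM2l (ltW t0) (ler_norm D); rewrite /D.
by rewrite !mulrBr; lra.
Qed.

(** Along [l + s mu] the negative entropy grows by at most [s D + s^2 Q], by [ln u <= u - 1]; at a
    minimiser the linear coefficient [D] has to vanish. *)
Lemma negentropy_min_orthogonal (l mu : I -> R) :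
    (forall i, 0 < l i) -> \sum_i mu i = 0 ->
    (forall s, (forall i, 0 <= l i + s * mu i) ->
       negentropy l <= negentropy (fun i => l i + s * mu i)) ->
  \sum_i mu i * ln (l i) = 0.
Proof.
move=> l_gt0 mu0 lmin; set D := \sum_i _.
pose Q := \sum_i mu i ^+ 2 / l i.
have Q0 : 0 <= Q by apply: sumr_ge0 => i _; rewrite divr_ge0 ?sqr_ge0 // ltW.
(* For [s = - D / N] the bound [s D + s^2 Q] is [D^2 (Q - N) / N^2], negative unless [D = 0] since
   [N > Q]. The last sum in [N] ensures [|s mu i| <= l i]. *)
pose N := Q + 1 + \sum_i `|D * mu i| / l i.
have S0 : 0 <= \sum_i `|D * mu i| / l i.
  by apply: sumr_ge0 => i _; rewrite divr_ge0 // ltW.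
have N0 : 0 < N by rewrite /N; lra.
pose s := - D / N.
have feas i : 0 <= l i + s * mu i.
  have : `|s * mu i| <= l i.
    have -> : s * mu i = - (D * mu i) / N by rewrite /s; ring.
    rewrite normrM normrN normfV (gtr0_norm N0) ler_pdivrMr //.
    have : `|D * mu i| / l i <= N.
      rewrite /N (bigD1 i) //=.
      have : 0 <= \sum_(j | j != i) `|D * mu j| / l j.
        by apply: sumr_ge0 => j _; rewrite divr_ge0 // ltW.
      by lra.
    by rewrite ler_pdivrMr // [l i * N]mulrC.
  by rewrite ler_norml => /andP[h _]; lra.
have term i : (l i + s * mu i) * ln (l i + s * mu i) <=
    l i * ln (l i) + s * (mu i * ln (l i)) + s * mu i + s ^+ 2 * (mu i ^+ 2 / l i).
  have := feas i; rewrite le_eqVlt => /orP[/eqP m0|m0].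
    have sm : s * mu i = - l i by lra.
    have -> : s ^+ 2 * (mu i ^+ 2 / l i) = l i.
      rewrite mulrA -exprMn sm sqrrN expr2 mulfK // gt_eqF //.
    by rewrite -m0 mul0r mulrA sm; lra.
  have li := l_gt0 i.
  have q0 : 0 < (l i + s * mu i) / l i by rewrite divr_gt0.
  have : ln (1 + ((l i + s * mu i) / l i - 1)) <= (l i + s * mu i) / l i - 1.
    by apply: le_ln1Dx; lra.
  rewrite addrC subrK ln_div ?posrE // => /(ler_wpM2l (feas i)).
  have -> : (l i + s * mu i) * ((l i + s * mu i) / l i - 1) =
     s * mu i + s ^+ 2 * (mu i ^+ 2 / l i) by field; rewrite gt_eqF.
  by rewrite mulrBr; lra.
have : negentropy l <= negentropy l + s * D + s ^+ 2 * Q.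
  apply: le_trans (lmin s feas) _; apply: le_trans (ler_sum _ (fun i _ => term i)) _.
  by rewrite !big_split /= -!mulr_sumr mu0 mulr0 addr0.
rewrite -addrA lerDl => h; apply/eqP; apply: contraT => D0.
have D2 : 0 < D ^+ 2 by rewrite exprn_even_gt0.
have : 0 <= D ^+ 2 * (Q - N).
  have -> : D ^+ 2 * (Q - N) = (s * D + s ^+ 2 * Q) * N ^+ 2.
    by rewrite /s; field; rewrite gt_eqF.
  by rewrite mulr_ge0 // sqr_ge0.
by rewrite pmulr_rge0 // /N; lra.
Qed.

(** The minimiser of the negative entropy on the fibre of [l0] is positive, and its logarithm is
    orthogonal to the kernel of [comb a], hence a combination of the columns of [a]. *)
Lemma gibbs_point (l0 : I -> R) : (forall i, 0 < l0 i) ->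
  exists theta : J -> R,
    comb a (fun i => expR (\sum_j theta j * a i j)) =1 comb a l0.
Proof.
move=> l0_gt0.
have cneg : continuous (negentropy : {ptws I -> R} -> R).
  apply: sum_continuous => i.
  exact: (@coord_continuous R I i (fun x => x * ln x) (@continuous_xlnx R)).
have [l [l_ge0 lx lmin]] :=
  comb_fiber_min (fun i => ltW (l0_gt0 i)) (fun _ => erefl) cneg.
have l_gt0 : forall i, 0 < l i.
  apply: (negentropy_min_gt0 l_ge0 l0_gt0) => t /andP[t0 t1]; apply: lmin => [i|j].
    by rewrite addr_ge0 // mulr_ge0 ?subr_ge0 ?(ltW t0) ?(ltW t1) ?(ltW (l0_gt0 i)).
  by rewrite combD !combZ lx -mulrDl subrK mul1r.
have [theta thetaE] : exists theta : J -> R,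
    forall i, ln (l i) = \sum_j theta j * a i j.
  apply: orthogonal_comb_kernel => mu mu0; apply: negentropy_min_orthogonal => //.
    by rewrite -comb_one mu0.
  by move=> s feas; apply: lmin => // j; rewrite combD combZ mu0 mulr0 addr0 lx.
exists theta => j; rewrite -lx; apply: eq_bigr => i _.
by rewrite -thetaE lnK // posrE.
Qed.

End Gibbs.

(** * Separating a point from a polytope *)

Section Separation.
Variables (R : realType) (I J : finType) (a : I -> J -> R).

(** Let [comb a l] be the point of the hull nearest to [y]. If it differs from [y], the direction
    [w] from it to [y] has some [a i] at least as far along [w] as [y], and moving towards [a i]
    comes closer to [y]. *)
Lemma convex_separation (y : J -> R) :
    (forall w : J -> R, exists i, \sum_j w j * y j <= \sum_j w j * a i j) ->
  exists l : I -> R, [/\ forall i, 0 <= l i, \sum_i l i = 1 & comb a l =1 y].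
Proof.
move=> dom; have [i0 _] := dom (fun=> 0).
pose one : I -> unit -> R := fun _ _ => 1.
pose f (l : {ptws I -> R}) := \sum_j (y j - comb a l j) ^+ 2.
have cf : continuous f.
  apply: sum_continuous => j l.
  apply: (@continuous_comp _ _ _ (fun l : {ptws I -> R} => comb a l j)
            (fun z : R => (y j - z) ^+ 2)); first exact: comb_continuous.
  have h : (fun z : R => y j - z) z @[z --> comb a l j] --> y j - comb a l j.
    by apply: cvgB; [exact: cvg_cst | exact: cvg_id].
  exact: (@continuous_comp _ _ _ (fun z : R => y j - z) (fun z : R => z ^+ 2) _ h
            (@exprn_continuous R 2 _)).
have comb1 l u : comb one l u = \sum_i l i by rewrite (comb_one (j0 := u)).
have [||l [l_ge0 l1 lmin]] :=
  comb_fiber_min (a := one) (j0 := tt) (fun _ => erefl) (x := fun=> 1)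
    (l0 := fun i => (i == i0)%:R) _ _ cf.
- by move=> i; rewrite ler0n.
- by move=> u; rewrite comb_delta.
exists l; split=> //; first by rewrite -(comb1 l tt) l1.
pose w j := y j - comb a l j; pose W := \sum_j w j ^+ 2.
have [i iw] := dom w; pose P := \sum_j (a i j - comb a l j) ^+ 2.
have W0 : 0 <= W by apply: sumr_ge0 => j _; exact: sqr_ge0.
have P0 : 0 <= P by apply: sumr_ge0 => j _; exact: sqr_ge0.
(* Moving by [t] towards [a i] must not decrease the squared distance, whose linear change is at
   most [- 2 t W]. *)
have ineq t : 0 < t <= 1 -> 2 * W <= t * P.
  move=> /andP[t0 t1].
  pose m i' := (1 - t) * l i' + t * (i' == i)%:R.
  have : f l <= f m.
    apply: lmin => [i'|u].
      by rewrite addr_ge0 // mulr_ge0 ?subr_ge0 // ltW.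
    by rewrite combD !combZ l1 comb_delta /one; ring.
  have -> : f m = W - 2 * t * (\sum_j w j * (a i j - comb a l j)) + t ^+ 2 * P.
    rewrite /W /P !mulr_sumr -sumrB -big_split /=; apply: eq_bigr => j _.
    by rewrite combD !combZ comb_delta /w; ring.
  have -> : \sum_j w j * (a i j - comb a l j) =
      W + (\sum_j w j * a i j - \sum_j w j * y j).
    by rewrite /W -sumrB -big_split /=; apply: eq_bigr => j _; rewrite /w; ring.
  have tI : 0 <= t * (\sum_j w j * a i j - \sum_j w j * y j).
    by rewrite mulr_ge0 ?subr_ge0 // ltW.
  have -> : f l = W by [].
  move=> h; have : 0 <= t * (t * P - 2 * W) by lra.
  by rewrite pmulr_rge0 //; lra.
have W00 : W = 0.
  apply/eqP; rewrite eq_le W0 andbT leNgt; apply/negP => Wp.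
  have WP : 0 < W + P by lra.
  (* This [t] turns [2 W <= t P] into [2 W^2 + W P <= 0]. *)
  have := ineq (W / (W + P)).
  rewrite divr_gt0 // ler_pdivrMr // mul1r lerDl P0 => /(_ isT).
  rewrite mulrAC ler_pdivlMr //; have := mulr_gt0 Wp Wp; have := mulr_ge0 W0 P0.
  by rewrite mulrDr; lra.
move=> j; apply/esym/eqP; rewrite -subr_eq0 -sqrf_eq0.
have /eqP := W00; rewrite psumr_eq0 => [/allP/(_ j)|k _]; last exact: sqr_ge0.
by apply; rewrite mem_index_enum.
Qed.

End Separation.

(** * Relative interiors of polytopes *)

Section Hulls.
Variables (R : realType) (I J : finType) (a : I -> J -> R^o).

Lemma convex_setE (A : set (J -> R^o)) : convex_set A <->
  forall (x y : J -> R^o) (t : R), 0 <= t <= 1 -> A x -> A y ->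
    A (t *: x + (1 - t) *: y).
Proof.
split=> [cA x y t /andP[t0 t1] Ax Ay|h x y t xA yA].
  by have := cA x y (Itv01 t0 t1); rewrite !inE; apply.
rewrite inE; apply: h; rewrite ?ge0 ?le1 //; first by rewrite inE in xA.
by rewrite inE in yA.
Qed.

(** Induction on the number of nonzero coefficients: split off one [i] and rescale the others by
    [1 / (1 - l i)]. *)
Lemma convex_comb_mem (A : set (J -> R^o)) : convex_set A ->
    (forall i, A (a i)) -> forall l : I -> R, (forall i, 0 <= l i) ->
  \sum_i l i = 1 -> A (comb a l).
Proof.
move=> /convex_setE cA Aa l; have [n] := ubnP #|[pred i | l i != 0]|.
elim: n l => // n IH l ltn l0 l1.
have [i li] : exists i, l i != 0.
  apply/existsP; apply: contraT; rewrite negb_exists => /forallP h.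
  move: l1; rewrite big1 => [/esym/eqP|i _]; first by rewrite oner_eq0.
  by apply/eqP; rewrite -[_ == _]negbK.
have S1 : \sum_(k | k != i) l k = 1 - l i.
  by rewrite -l1 [in RHS](bigD1 i) //= [in RHS]addrC addrK.
have le1 : l i <= 1 by rewrite -subr_ge0 -S1 sumr_ge0.
(* If [l i = 1] the rescaling would divide by zero, but then the combination is [a i] itself. *)
have [/eqP i1|i1] := eqVneq (l i) 1.
  have lE k : l k = (k == i)%:R.
    have [->|ki] := eqVneq k i; first exact/eqP.
    apply/eqP; move: S1; rewrite (eqP i1) subrr => /eqP.
    by rewrite psumr_eq0 => [/allP/(_ k (mem_index_enum k))/implyP|]; [apply | ].
  suff -> : comb a l = a i by exact: Aa.
  by apply/funext => j; rewrite -[RHS](comb_delta a); apply: eq_bigr => k _; rewrite lE.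
have d0 : 0 < 1 - l i by rewrite subr_gt0 lt_neqAle i1.
pose m k := if k == i then 0 else l k / (1 - l i).
have mE k : l k = l i * (k == i)%:R + (1 - l i) * m k.
  rewrite /m; case: eqVneq => [->|_]; first by rewrite mulr1 mulr0 addr0.
  by rewrite mulr0 add0r mulrC divfK // gt_eqF.
have -> : comb a l = l i *: a i + (1 - l i) *: comb a m.
  apply/funext => j.
  transitivity (comb a (fun k => l i * (k == i)%:R + (1 - l i) * m k) j).
    by apply: eq_bigr => k _; rewrite -mE.
  by rewrite combD !combZ comb_delta.
apply: cA => //; first by rewrite l0.
apply: IH.
- apply: leq_trans (ltn : (_ <= n)%N); apply/proper_card/properP; split.
    apply/fintype.subsetP => k; rewrite !inE /m.
    case: (eqVneq k i) => [|_]; first by rewrite eqxx.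
    by apply: contraNneq => ->; rewrite mul0r.
  by exists i; rewrite ?inE // /m eqxx eqxx.
- by move=> k; rewrite /m; case: ifP => // _; rewrite divr_ge0 // ltW.
rewrite /m (bigD1 i) //= eqxx add0r.
under eq_bigr => k /negbTE -> do [].
by rewrite -mulr_suml S1 divff // gt_eqF.
Qed.

Definition simplex_image (x : J -> R^o) := exists l : I -> R,
  [/\ forall i, 0 <= l i, \sum_i l i = 1 & comb a l =1 x].

Lemma convex_hullE : convex_hull (range a) = simplex_image :> set (J -> R^o).
Proof.
apply/seteqP; split=> x.
  apply: smallest_sub; last first.
    move=> _ [i _ <-]; exists (fun k => (k == i)%:R); split=> [k||j].
    - exact: ler0n.
    - by rewrite (bigD1 i) //= eqxx big1 ?addr0 // => k /negbTE ->.
    - exact: comb_delta.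
  apply/convex_setE => y z t /andP[t0 t1] [l [l0 l1 ly]] [m [m0 m1 mz]].
  exists (fun i => t * l i + (1 - t) * m i); split=> [i||j].
  - by rewrite addr_ge0 // mulr_ge0 // subr_ge0.
  - by rewrite big_split /= -!mulr_sumr l1 m1; ring.
  - by rewrite combD !combZ ly mz.
move=> [l [l0 l1 lx]] A [cA rA].
have -> : x = comb a l by apply/funext => j; rewrite lx.
by apply: convex_comb_mem => // i; apply: rA; exists i.
Qed.

Let P := convex_hull (range a).

Lemma affine_hull_comb x : affine_hull P x ->
  exists2 m : I -> R, \sum_i m i = 1 & comb a m =1 x.
Proof.
pose B := [set x : J -> R^o | exists2 m : I -> R, \sum_i m i = 1 & comb a m =1 x].
apply: (@smallest_sub _ _ _ B) => [y z t [m m1 my] [n n1 nz]|y].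
  exists (fun i => t * m i + (1 - t) * n i) => [|j].
    by rewrite big_split /= -!mulr_sumr m1 n1; ring.
  by rewrite combD !combZ my nz.
by rewrite /P convex_hullE => -[l [_ l1 ly]]; exists l.
Qed.

Lemma sub_affine_hull (A : set (J -> R^o)) : A `<=` affine_hull A.
Proof. by move=> x Ax B [_]; apply. Qed.

Lemma affine_affine_hull (A : set (J -> R^o)) : affine_set (affine_hull A).
Proof.
move=> x y t Ax Ay B hB; apply: hB.1; [exact: Ax | exact: Ay].
Qed.

Lemma relative_interior_near (A : set (J -> R^o)) x : A x ->
  relative_interior A x <->
  \forall y \near (x : {ptws J -> R}), affine_hull A y -> A y.
Proof.
move=> Ax.
have e := @nbhs_subspace_in {ptws J -> R} (affine_hull A) x (sub_affine_hull Ax).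
exact: (eq_ind _ (fun F : set_system _ => F A <-> _) (iff_refl _) _ e).
Qed.

Lemma relative_interior_convex_hull x : relative_interior P x <->
  exists l : I -> R, [/\ forall i, 0 < l i, \sum_i l i = 1 & comb a l =1 x].
Proof.
split=> [rx|[l [l0 l1 lx]]].
  have Px : P x := nbhs_singleton rx.
  have [l [l0 l1 lx]] : simplex_image x by rewrite -convex_hullE.
  have I0 : (0 < #|I|)%N.
    rewrite lt0n; apply/negP => /eqP I0; move: l1.
    rewrite big1 => [/esym/eqP|i _]; first by rewrite oner_eq0.
    by have := fintype0 i I0.
  pose u : R := #|I|%:R^-1.
  have u0 : 0 < u by rewrite invr_gt0 ltr0n.
  have u1 : \sum_(i : I) u = 1.
    by rewrite sumr_const -[u *+ _]mulr_natr mulVf // pnatr_eq0 -lt0n.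
  pose b : J -> R^o := comb a (fun=> u).
  have Pb : P b.
    by rewrite /P convex_hullE; exists (fun=> u); split=> // i; exact: ltW.
  (* [f t] lies beyond [x] on the line from the barycentre [b], within the affine hull, so in [P]
     for some small [t > 0]. Then [x = (f t + t b) / (1 + t)] inherits positive coefficients from
     [b]. *)
  pose f (t : R) : {ptws J -> R} := fun j => (1 + t) * x j + - t * b j.
  have fx : f t @[t --> (0 : R)^'+] --> (x : {ptws J -> R}).
    apply: ptws_cvg => j; apply: cvg_at_right_filter.
    rewrite (_ : x j = (1 + 0) * x j + - 0 * b j); last by ring.
    apply: cvgD; apply: cvgMl.
      by apply: cvgD; [exact: cvg_cst | exact: cvg_id].
    by apply: cvgN; exact: cvg_id.
  have [t [t0 Pt]] : exists t, 0 < t /\ P (f t).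
    apply: (@filter_ex _ (0 : R)^'+); near=> t; split; first by near: t; exact: nbhs_right_gt.
    have aff : affine_hull P (f t).
      have := affine_affine_hull (1 + t) (sub_affine_hull Px) (sub_affine_hull Pb).
      by congr (affine_hull P _); apply/funext => j; rewrite /f !fctE; congr (_ + _ * _); ring.
    move: aff; near: t.
    exact: (fx [set y | affine_hull P y -> P y] ((relative_interior_near Px).1 rx)).
  move: Pt; rewrite /P convex_hullE => -[m [m0 m1 mf]].
  have t1 : 0 < 1 + t by rewrite addr_gt0.
  exists (fun i => (1 + t)^-1 * (m i + t * u)); split=> [i||j].
  - by rewrite mulr_gt0 ?invr_gt0 // ltr_wpDl // mulr_gt0.
  - rewrite -mulr_sumr big_split /= -mulr_sumr m1 u1 mulr1 mulVf //.
    by rewrite gt_eqF.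
  - rewrite combZ combD combZ mf /f -/(b j).
    by rewrite mulNr -addrA addNr addr0 mulKf // gt_eqF.
have Px : P x.
  by rewrite /P convex_hullE; exists l; split=> // i; exact: ltW.
apply/(relative_interior_near Px).
(* The column [None] records the sum of the coefficients. *)
pose a' i (j : option J) : R := if j is Some j then a i j else 1.
have [C HC] := comb_section a'.
(* The section applied to [y - x] with total mass [0]: a change of coefficients that is continuous
   in [y] and vanishes at [x]. *)
pose mu (y : {ptws J -> R}) i := \sum_j (y j - x j) * C (Some j) i.
have mux i : mu y i @[y --> (x : {ptws J -> R})] --> 0.
  have -> : 0 = mu x i by rewrite /mu big1 // => j _; rewrite subrr mul0r.
  have cmu : continuous (fun y : {ptws J -> R} => mu y i).
    apply: sum_continuous => j.
    apply: (@coord_continuous R J j (fun z => (z - x j) * C (Some j) i)) => z.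
    by apply: cvgMl; apply: cvgB; [exact: cvg_id | exact: cvg_cst].
  exact: cmu.
have : \forall y \near (x : {ptws J -> R}), forall i, - l i < mu y i.
  apply: (@filter_forall _ I (fun i (y : {ptws J -> R}) => - l i < mu y i)
            (nbhs (x : {ptws J -> R})) _) => i.
  by apply: (cvgr_gt _ (mux i)); rewrite oppr_lt0.
apply: filterS => y ly /affine_hull_comb[m m1 my].
have comb'S n j : comb a' n (Some j) = comb a n j by [].
have comb'N n : comb a' n None = \sum_i n i by rewrite (comb_one (j0 := None)).
(* [d] carries [x] to [y] but need not be small; [mu y] has the same image under [comb a'] and is
   small enough to keep [l + mu y] nonnegative. *)
pose d i := m i + -1 * l i.
have dN : comb a' d None = 0 by rewrite combD combZ !comb'N m1 l1 mulr1 subrr.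
have dS j : comb a' d (Some j) = y j - x j.
  by rewrite combD combZ !comb'S my lx mulN1r.
have muE : mu y =1 fun i => \sum_j comb a' d j * C j i.
  move=> i; rewrite (bigD1 None) //= dN mul0r add0r.
  rewrite (reindex_omap Some id) //= => [|[j|] //].
  by apply: eq_big => [j|j _]; rewrite ?eqxx // dS.
have muC j : comb a' (mu y) j = comb a' d j.
  by rewrite -(HC d); apply: eq_bigr => i _; rewrite muE.
rewrite /P convex_hullE; exists (fun i => l i + mu y i); split=> [i||j].
- by have := ly i; lra.
- by rewrite big_split /= l1 -comb'N muC dN addr0.
- by rewrite combD lx -comb'S muC dS addrC subrK.
Unshelve. all: by end_near.
Qed.

End Hulls.

(** * Resistances *)

Lemma image_pred_range (I : Type) (U : Type) (P : pred I) (F : I -> U) :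
  [set F i | i in [set i | P i]] = range (fun s : {i | P i} => F (val s)).
Proof.
apply/seteqP; split=> [_ [i Pi <-]|_ [s _ <-]]; first by exists (exist _ i Pi).
by exists (val s) => //; exact: (valP s).
Qed.

Lemma sum_sig (R : nmodType) (I : finType) (P : pred I) (F : I -> R) :
  \sum_(i | P i) F i = \sum_(s : {i | P i}) F (val s).
Proof. exact: (@big_sub _ _ _ I P F). Qed.

Lemma sum_comb_indicator (R : realType) (E : finType) (S : pred {set E})
    (l : {A | S A} -> R) (B : {set E}) :
  \sum_(e in B) comb (fun (s : {A | S A}) e => (e \in val s)%:R) l e =
  \sum_s l s * #|val s :&: B|%:R.
Proof.
rewrite exchange_big /=; apply: eq_bigr => s _; rewrite -mulr_sumr; congr (_ * _).
rewrite -natr_sum -big_mkcondr /= sum1dep_card; congr (_%:R).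
by apply: eq_card => e; rewrite !inE andbC.
Qed.

Section Resistance.
Variables (R : realType) (V : finType) (adj : rel V).
Hypothesis adj_irr : irreflexive adj.
Let E := edge adj.
Let tree := {T : {set E} | spanning_tree T}.
Let tree_vec (t : tree) : E -> R^o := indicator_vec R (val t).
Let matching_vec (M : {M : {set E} | matching M}) : E -> R^o :=
  indicator_vec R (val M).

Lemma relint_tree_polytope (x : E -> R^o) :
  relative_interior (spanning_tree_polytope adj R) x <->
  exists l : tree -> R, [/\ forall t, 0 < l t, \sum_t l t = 1 & comb tree_vec l =1 x].
Proof.
rewrite /spanning_tree_polytope image_pred_range.
exact: relative_interior_convex_hull.
Qed.

Lemma matching_polytopeE :
  matching_polytope adj R = simplex_image matching_vec :> set (E -> R^o).
Proof. by rewrite /matching_polytope image_pred_range convex_hullE. Qed.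

Lemma tree_weights_gt0 (c : E -> R) : (forall e, 0 < c e) ->
  0 < \sum_(T : {set E} | spanning_tree T) \prod_(t in T) c t.
Proof.
move=> c0; have [T sT] := ex_spanning_tree adj.
rewrite (bigD1 T) //= ltr_pwDl //; first by apply: prodr_gt0.
by apply: sumr_ge0 => T' _; apply: prodr_ge0 => e _; apply: ltW.
Qed.

Lemma relative_resistance_comb (c : E -> R) (e : E) :
  relative_resistance c e =
  comb tree_vec (fun t => (\prod_(i in val t) c i) /
    (\sum_(T : {set E} | spanning_tree T) \prod_(i in T) c i)) e.
Proof.
rewrite /relative_resistance /comb; set Z := (X in _ / X = _).
rewrite mulr_suml big_mkcondr sum_sig /=; apply: eq_bigr => T _.
by rewrite /tree_vec /indicator_vec; case: ifP; rewrite ?mulr1 ?mulr0.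
Qed.

Lemma relative_resistance_relint (c : E -> R) : (forall e, 0 < c e) ->
  relative_interior (spanning_tree_polytope adj R) (relative_resistance c).
Proof.
move=> c0; apply/relint_tree_polytope; have Z0 := tree_weights_gt0 c0.
eexists; split; last by move=> e; rewrite relative_resistance_comb.
  by move=> t /=; rewrite divr_gt0 //; apply: prodr_gt0.
by rewrite /= -mulr_suml -(sum_sig _ (fun T : {set E} => \prod_(i in T) c i)) divff ?gt_eqF.
Qed.

Lemma relint_relative_resistance (x : E -> R^o) :
    relative_interior (spanning_tree_polytope adj R) x ->
  exists2 c : E -> R, forall e, 0 < c e & relative_resistance c =1 x.
Proof.
move=> /relint_tree_polytope[l [l0 l1 lx]].
(* The column [None] of ones imposes the normalisation; its multiplier becomes [K], the reciprocal
   of the weighted count of trees. *)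
pose a' t (j : option E) : R := if j is Some e then tree_vec t e else 1.
have [theta thetaE] := @gibbs_point _ _ _ a' None (fun _ => erefl) l l0.
pose c e := expR (theta (Some e)); exists c => [e|e]; first exact: expR_gt0.
pose K := expR (theta None).
have gE t : expR (\sum_j theta j * a' t j) = K * \prod_(e in val t) c e.
  rewrite (bigD1 None) //= mulr1 expRD; congr (_ * _).
  rewrite /c -expR_sum; congr expR.
  rewrite (reindex_omap Some id) //= => [|[j|] //].
  rewrite [RHS]big_mkcond; apply: eq_big => [j|j _]; first by rewrite eqxx.
  by rewrite /tree_vec /indicator_vec; case: ifP; rewrite ?mulr1 ?mulr0.
have g1 : K * \sum_(T : {set E} | spanning_tree T) \prod_(i in T) c i = 1.
  rewrite sum_sig mulr_sumr -[RHS]l1 -(comb_one (a := a') (j0 := None)) // -thetaE.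
  by apply: eq_bigr => t _; rewrite gE /= mulr1.
rewrite relative_resistance_comb -lx -[RHS](thetaE (Some e)); apply: eq_bigr => t _.
have Z0 : \sum_(T : {set E} | spanning_tree T) \prod_(i in T) c i != 0.
  by rewrite gt_eqF // tree_weights_gt0 // => i; exact: expR_gt0.
rewrite gE [K * _]mulrC; congr (_ * _ * _).
by apply: (mulIf Z0); rewrite mulVf // g1.
Qed.

Lemma matching_polytope_degree (y : E -> R^o) (v : V) :
  matching_polytope adj R y -> \sum_(e : E | v \in val e) y e <= 1.
Proof.
rewrite matching_polytopeE => -[l [l0 l1 ly]].
have -> : \sum_(e : E | v \in val e) y e =
    \sum_(e in [set e : E | v \in val e]%SET) comb matching_vec l e.
  by apply: eq_big => [e|e _]; rewrite ?inE // ly.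
rewrite sum_comb_indicator -[leRHS]l1; apply: ler_sum => M _.
rewrite ler_piMr // lern1.
have /forallP/(_ v) := valP M; apply: leq_trans; apply/eq_leq/eq_card => e.
by rewrite !inE.
Qed.

Lemma half_tree_polytope_matching (x : E -> R^o) (l : tree -> R) :
    (forall t, 0 <= l t) -> \sum_t l t = 1 -> comb tree_vec l =1 x ->
    (forall v, \sum_(e : E | v \in val e) x e <= 2) ->
  matching_polytope adj R (2^-1 *: x).
Proof.
move=> l0 l1 lx deg; rewrite matching_polytopeE.
have feas : edmonds_feasible (fun e : E => val e) (fun e => 2^-1 * x e).
  split=> [e|v|K K1].
  - rewrite mulr_ge0 // -lx; apply: sumr_ge0 => t _.
    by rewrite mulr_ge0 // ler0n.
  - by rewrite -mulr_sumr; have := deg v; lra.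
  (* The [2] cancels the half; what remains is the forest bound [|T within K| + 1 <= |K|] averaged
     over the trees with weights [l]. *)
  - rewrite -mulr_sumr mulrA divff // mul1r.
    under eq_bigr do rewrite -lx.
    rewrite sum_comb_indicator -[X in _ + X]l1 -big_split /=.
    rewrite -[leRHS]mul1r -[X in _ <= X * _]l1 mulr_suml; apply: ler_sum => t _.
    rewrite -[X in _ + X]mulr1 -mulrDr ler_wpM2l // natr1 ler_nat.
    apply: card_acyclic_within => //; last exact: leq_trans K1.
    exact: spanning_tree_acyclic (valP t).
(* For every objective [w], a matching of maximal weight dominates the feasible vector by Edmonds'
   bound, so no hyperplane separates that vector from the matchings. *)
apply: convex_separation => w.
have [M mM] := ex_max_matching (fun e : E => val e) w.
have [hM _] := max_matchingP _ _ _ mM.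
exists (exist _ M hM); apply: le_trans (edmonds_dual (card_edge adj_irr) feas mM) _.
rewrite /weight big_mkcond /=; apply: ler_sum => e _.
by rewrite /matching_vec /indicator_vec /=; case: ifP; rewrite ?mulr1 ?mulr0.
Qed.

End Resistance.

Theorem theorem4p1 (R : realType) (V : finType) (adj : rel V)
    (adj_sym : symmetric adj) (adj_irr : irreflexive adj)
    (adj_conn : forall u v : V, connect adj u v) :
  resistance_nonnegative adj R <->
  relative_interior (spanning_tree_polytope adj R) `&`
    dilate 2 (matching_polytope adj R) !=set0.
Proof.
have curvature (c : edge adj -> R) v : 0 <= resistance_curvature c v =
    (\sum_(e : edge adj | v \in val e) relative_resistance c e <= 2).
  by rewrite /resistance_curvature subr_ge0 ler_pdivrMl // mulr1.
split=> [[c [c0 pc]]|[x [/relint_relative_resistance[c c0 cx] [y My yx]]]].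
  exists (relative_resistance c : edge adj -> R^o).
  have rel := relative_resistance_relint c0; split=> //.
  have [l [l0 l1 lx]] := (relint_tree_polytope _).1 rel.
  exists (2^-1 *: (relative_resistance c : edge adj -> R^o)).
    apply: (half_tree_polytope_matching adj_irr (fun t => ltW (l0 t)) l1 lx) => v.
    by rewrite -curvature.
  by rewrite scalerA divff // scale1r.
(* Here [x = 2 y] with [y] in the matching polytope, where the degree of each vertex is at most
   [1]. *)
exists c; split=> // v; rewrite curvature.
under eq_bigr do rewrite cx -yx.
rewrite -mulr_sumr -[leRHS]mulr1 ler_pM2l //.
exact: matching_polytope_degree.
Qed.
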